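(* For every $\delta\in(0,2)$ there exists a Banach space $X$ such that every convex combination of slices of $B_X$ has diameter $\geq\delta$ but such that, for every $\varepsilon>0$, there exists a slice $S$ of $B_X$ such that $\operatorname{diam}(S)\leq\delta+\varepsilon$.
   Context: All Banach spaces are nontrivial and real. $B_X$ and $S_X$ denote the closed unit ball and the unit sphere of $X$, and $X^*$ is the dual. A slice of $B_X$ is a set $S(B_X,x^*,\alpha)=\{x\in B_X: x^*(x)>1-\alpha\}$ with $x^*\in S_{X^*}$ and $\alpha>0$. A convex combination of slices of $B_X$ is a set $\sum_{i=1}^n\lambda_iS(B_X,x_i^*,\alpha_i)=\{\sum_i\lambda_ix_i: x_i\in S(B_X,x_i^*,\alpha_i)\}$ with $n\in\mathbb N$, $\lambda_i\in[0,1]$, $\sum_{i=1}^n\lambda_i=1$. *)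

(* Defs.v *)
From HB Require Import structures.
From mathcomp Require Import all_boot all_order all_algebra.
From mathcomp Require Import all_classical all_reals all_analysis.

Set Implicit Arguments.
Unset Strict Implicit.
Unset Printing Implicit Defensive.

Import Order.TTheory GRing.Theory Num.Theory.
Import numFieldNormedType.Exports.

Local Open Scope classical_set_scope.
Local Open Scope ring_scope.

Section Slices.
Context {R : realType} {X : normedModType R}.

Definition unit_ball : set X := [set x | `|x| <= 1].

(* [sup] is a junk value when the set is unbounded, so this is the dual norm
   only for continuous functionals. *)
Definition dual_norm (f : {linear X -> R^o}) : R :=
  sup [set `|f x| | x in unit_ball].

Definition dual_sphere : set {linear X -> R^o} :=
  [set f : {linear X -> R^o} | continuous f /\ dual_norm f = 1].

Definition slice (f : {linear X -> R^o}) (a : R) : set X :=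
  [set x | unit_ball x /\ 1 - a < f x].

Definition is_slice (S : set X) : Prop :=
  exists (f : {linear X -> R^o}) (a : R),
    [/\ dual_sphere f, 0 < a & S = slice f a].

Definition convex_comb n (l : 'I_n -> R) (S : 'I_n -> set X) : set X :=
  [set \sum_(i < n) l i *: x i | x in [set x : 'I_n -> X | forall i, S i (x i)]].

(* The case [n = 0] is excluded by the condition on the sum of the weights. *)
Definition is_convex_comb_slices (C : set X) : Prop :=
  exists (n : nat) (l : 'I_n -> R) (S : 'I_n -> set X),
    [/\ forall i, 0 <= l i <= 1,
        \sum_(i < n) l i = 1,
        forall i, is_slice (S i)
      & C = convex_comb l S].

Definition diam (A : set X) : \bar R :=
  ereal_sup [set (`|x - y|)%:E | x in A & y in A].

End Slices.

(* Main.v *)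
(** Let [c = 1 - delta / 2] and let [X] be the space of bounded real sequences
    with the norm [sup_n (|x n| + [n > 0] c |x 0|)], an equivalent renorming of
    [l_infinity].  The slice [{x in B_X | x 0 > 1 - a}] is thin: its points have
    [|x n| <= 1 - c (1 - a)] for [n > 0], so its diameter is at most
    [delta + 3 a].  On the other hand, replacing a coordinate [n > 0] of a point
    of [B_X] by any [s] with [|s| <= 1 - c = delta / 2] stays in [B_X]; as the
    unit vectors [e n] are weakly null, every slice contains, for all large [n],
    a segment [[y, y + delta e n]].  Finitely many slices share such an [n], so
    each of their convex combinations contains a translate of [[0, delta e n]],
    which has length at least [delta]. *)
Require Import Defs.
From HB Require Import structures.
From mathcomp Require Import all_boot all_order all_algebra.
From mathcomp Require Import all_classical all_reals all_analysis.
From mathcomp Require Import lra.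

Set Implicit Arguments.
Unset Strict Implicit.
Unset Printing Implicit Defensive.

Import Order.TTheory GRing.Theory Num.Theory.
Import numFieldNormedType.Exports.

Local Open Scope classical_set_scope.
Local Open Scope ring_scope.

(** * Functionals of norm one and their slices *)

Section DualSphere.
Context {R : realType} {X : normedModType R}.
Variables (f : {linear X -> R^o}) (f1 : dual_sphere f).

(** [sup] defaults to 0 where no supremum exists, so the value 1 must be a genuine supremum. *)
Lemma dual_sphere_has_sup : has_sup [set `|f x| | x in unit_ball].
Proof.
apply: contrapT => /sup_out fsup; case: f1 => _; rewrite /dual_norm fsup.
by move/eqP; rewrite eq_sym oner_eq0.
Qed.

Lemma dual_sphere_le1 x : `|x| <= 1 -> `|f x| <= 1.
Proof.
move=> x1; case: (f1) => _ <-.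
by apply: (sup_upper_bound dual_sphere_has_sup); exists x.
Qed.

Lemma slice_neq0 a : 0 < a -> slice f a !=set0.
Proof.
move=> a0; have [_ [x x1 <-]] := sup_adherent a0 dual_sphere_has_sup.
rewrite (_ : sup _ = 1); last by case: f1.
have [fx0|fx0] := leP 0 (f x).
  by rewrite ger0_norm// => fx; exists x.
(* The near-maximiser of [|f|] may have the wrong sign; the ball is symmetric. *)
rewrite ltr0_norm// => fx; exists (- x).
by split; [rewrite /unit_ball/= normrN|rewrite linearN].
Qed.

End DualSphere.

(** * The renormed space of bounded sequences *)

Section BoundedSequences.
Variable R : realType.

Definition bounded_seq : {pred nat -> R^o} :=
  mem [set x : nat -> R^o | exists M : R, forall n, `|x n| <= M].

Lemma bounded_seqP (x : nat -> R^o) :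
  reflect (exists M : R, forall n, `|x n| <= M) (x \in bounded_seq).
Proof. by apply: (iffP idP) => [/set_mem|/mem_set]. Qed.

Lemma bounded_seq_submod_closed : submod_closed bounded_seq.
Proof.
split=> [|a x y /bounded_seqP[M xM] /bounded_seqP[N yN]]; apply/bounded_seqP.
  by exists 0 => n; rewrite normr0.
exists (`|a| * M + N) => n; rewrite (le_trans (ler_normD _ _))// lerD//.
by rewrite normrZ ler_wpM2l.
Qed.

HB.instance Definition _ := GRing.isSubmodClosed.Build _ _ bounded_seq
  bounded_seq_submod_closed.

(* The index [c] carries no data: it lets the norm depend on [c] through
   canonical structure inference. *)
Record bseq (c : {nonneg R}) :=
  BSeq { bseq_val :> nat -> R^o; bseqP : bseq_val \in bounded_seq }.

Section Norm.
Variable c : {nonneg R}.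

HB.instance Definition _ := [isSub of bseq c for @bseq_val c].
HB.instance Definition _ := [Choice of bseq c by <:].
HB.instance Definition _ := [SubChoice_isSubLmodule of bseq c by <:].

Implicit Types (x y : bseq c) (n : nat).

Definition bseq_seminorm n x : R := `|x n| + c%:num *+ (n != 0)%N * `|x 0%N|.

Definition bseq_norm x : R := sup [set bseq_seminorm n x | n in setT].

Lemma bseq_norm_has_sup x : has_sup [set bseq_seminorm n x | n in setT].
Proof.
have [M xM] := bounded_seqP _ (bseqP x).
split; first by exists (bseq_seminorm 0 x), 0%N.
exists (M + c%:num * M) => _ [n _ <-]; rewrite lerD//.
have M0 : 0 <= M by rewrite (le_trans _ (xM 0%N)).
by case: (n != _); rewrite /= ?mulr1n ?mulr0n ?mul0r ?mulr_ge0// ler_wpM2l.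
Qed.

Lemma bseq_seminorm_le n x : bseq_seminorm n x <= bseq_norm x.
Proof. by apply: (sup_upper_bound (bseq_norm_has_sup x)); exists n. Qed.

Lemma bseq_norm_le x (M : R) :
  (forall n, bseq_seminorm n x <= M) -> bseq_norm x <= M.
Proof.
move=> xM; apply: ge_sup; first exact: (bseq_norm_has_sup x).1.
by move=> _ [n _ <-].
Qed.

Lemma coord_le_bseq_norm n x : `|x n| <= bseq_norm x.
Proof.
by apply: le_trans (bseq_seminorm_le n x); rewrite lerDl mulr_ge0// mulrn_wge0.
Qed.

Lemma bseq_normD x y : bseq_norm (x + y) <= bseq_norm x + bseq_norm y.
Proof.
apply: bseq_norm_le => n.
apply: le_trans (lerD (bseq_seminorm_le n x) (bseq_seminorm_le n y)).
rewrite /bseq_seminorm addrACA -mulrDr lerD ?ler_normD//.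
by rewrite ler_wpM2l ?mulrn_wge0// ler_normD.
Qed.

Lemma bseq_seminormZ n (a : R) x :
  bseq_seminorm n (a *: x) = `|a| * bseq_seminorm n x.
Proof. by rewrite /bseq_seminorm !normrZ mulrDr mulrCA. Qed.

Lemma bseq_normZ (a : R) x : bseq_norm (a *: x) = `|a| * bseq_norm x.
Proof.
have leZ b y : bseq_norm (b *: y) <= `|b| * bseq_norm y.
  apply: bseq_norm_le => n.
  by rewrite bseq_seminormZ ler_wpM2l// bseq_seminorm_le.
apply/eqP; rewrite eq_le leZ/=; have [->|a0] := eqVneq a 0.
  by rewrite normr0 mul0r (le_trans _ (coord_le_bseq_norm 0 _)).
(* The reverse inequality is [leZ] at the scalar [a^-1] and the vector [a *: x]. *)
rewrite -ler_pdivlMl ?normr_gt0// -normfV.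
by rewrite -{1}[x](scalerK a0) leZ.
Qed.

Lemma bseq_norm_eq0 x : bseq_norm x = 0 -> x = 0.
Proof.
move=> x0; apply/val_inj/funext => n; apply/normr0_eq0/le_anti.
by rewrite normr_ge0 -[X in _ <= X]x0 coord_le_bseq_norm.
Qed.

HB.instance Definition _ := Lmodule_isNormed.Build R (bseq c)
  bseq_normD bseq_normZ bseq_norm_eq0.

(** * Completeness *)

Lemma bseqBE n x y : (x - y) n = x n - y n.
Proof. by []. Qed.

Lemma coord_cvg (F : set_system (bseq c)) n : ProperFilter F -> cauchy F ->
  cvg ((fun x : bseq c => x n : R) @ F).
Proof.
move=> FF /cauchy_ballP Fc; apply: R_complete; apply/cauchy_ballP => e e0.
rewrite near_map2; apply: filterS (Fc _ e0) => -[x y].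
by rewrite -ball_normE /ball/= -bseqBE; exact/le_lt_trans/coord_le_bseq_norm.
Qed.

Lemma bseq_complete (F : set_system (bseq c)) :
  ProperFilter F -> cauchy F -> cvg F.
Proof.
move=> FF Fcauchy.
pose l n : R^o := lim ((fun x : bseq c => x n : R) @ F).
have Fl n : (fun x : bseq c => x n : R) @ F --> (l n : R) by exact: coord_cvg.
(* [F] contains a ball of radius 1, whose center [x0] bounds the pointwise limit up to 1. *)
have lb : l \in bounded_seq.
  have [x0 Fx0] := (cauchyP F).1 Fcauchy 1 ltr01.
  apply/bounded_seqP; exists (bseq_norm x0 + 1) => n.
  apply: (cvgr_to_le (cvg_norm (Fl n))).
  apply: filterS Fx0 => x; rewrite -ball_normE /ball_/= distrC => x0x.
  rewrite -(subrK (x0 n) (x n)) addrC (le_trans (ler_normD _ _))//.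
  rewrite lerD ?coord_le_bseq_norm// -bseqBE ltW//.
  exact/le_lt_trans/x0x/coord_le_bseq_norm.
apply/cvg_ex; exists (BSeq c lb); apply/cvgrPdist_le => e e0.
have Fc := (cauchy_ballP F).2 Fcauchy.
near=> x; apply: bseq_norm_le => n; rewrite -[leLHS]/(bseq_seminorm n (_ - x)).
rewrite /bseq_seminorm !bseqBE/=.
have Fdist m : (fun y : bseq c => `|y m - x m|) @ F --> `|l m - x m|.
  by apply: cvg_norm; apply: cvgB; [exact: Fl|exact: cvg_cst].
(* The seminorm of the limit minus [x] is a limit over [y] of those of [y - x], bounded by [e]
   uniformly in [n] by the Cauchy property. *)
apply: (cvgr_to_le (cvgD (Fdist n) (cvgMl_tmp (Fdist 0%N)))).
near=> y; apply: le_trans (bseq_seminorm_le n (y - x)) _.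
have : ball x e y by near: y; near: x; apply: nearP_dep; exact: Fc.
by rewrite -ball_normE /ball_/= distrC => /ltW.
Unshelve. all: by end_near. Qed.

HB.instance Definition _ := Uniform_isComplete.Build (bseq c) bseq_complete.

(** * Coordinate functionals and unit vectors *)

Definition coord n (x : bseq c) : R^o := x n.

Lemma coord_is_linear n : linear (coord n).
Proof. by []. Qed.

HB.instance Definition _ n :=
  GRing.isLinear.Build R (bseq c) R^o _ (coord n) (@coord_is_linear n).

Lemma unit_vec_bounded n : (fun m => (m == n)%:R) \in bounded_seq.
Proof.
by apply/bounded_seqP; exists 1 => m; case: eqP; rewrite ?normr1 ?normr0.
Qed.

Definition unit_vec n : bseq c := BSeq c (unit_vec_bounded n).

Lemma norm_unit_vec_ge1 n : 1 <= `|unit_vec n|.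
Proof.
by have := coord_le_bseq_norm n (unit_vec n); rewrite /= eqxx normr1.
Qed.

(** Index 0 is avoided, so the term in [c] vanishes, and every coordinate of the sum is 0 or a
    single [s n]. *)
Lemma norm_sum_unit_vec_le1 (s : nat -> R) N : (forall n, `|s n| <= 1) ->
  `|\sum_(0 <= n < N) s n *: unit_vec n.+1| <= 1.
Proof.
move=> s1; apply: bseq_norm_le => m; set z := \sum_(_ <= _ < _) _.
have zE k : z k = \sum_(0 <= n < N) s n * (k == n.+1)%:R.
  by rewrite -[LHS]/(coord k z) /z raddf_sum.
rewrite /bseq_seminorm !zE.
rewrite [X in _ * `|X|]big1 ?normr0 ?mulr0 ?addr0 => [|n _]; last by rewrite mulr0.
case: m => [|m]; first by rewrite big1 ?normr0// => n _; rewrite mulr0.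
have [mN|Nm] := ltnP m N.
  rewrite (bigD1_seq m) ?mem_index_iota ?iota_uniq//= eqxx mulr1.
  by rewrite big1 ?addr0// => n /negPf nm; rewrite eqSS eq_sym nm mulr0.
rewrite big_nat big1 ?normr0// => n /= nN.
by rewrite eqSS gtn_eqF ?mulr0// (leq_trans nN).
Qed.

(** Evaluating [f] at sums of unit vectors with matching signs bounds the partial sums of
    [|f (unit_vec n.+1)|] by 1; the series converges, so its terms tend to 0. *)
Lemma unit_vec_weakly_null (f : {linear bseq c -> R^o}) : dual_sphere f ->
  f (unit_vec n.+1) @[n --> \oo] --> (0 : R).
Proof.
move=> f1; apply/norm_cvg0P.
apply: (@cvg_series_cvg_0 _ R^o); apply: nondecreasing_is_cvgn.
  apply/nondecreasing_seqP => N; rewrite /series/= big_nat_recr//= lerDl.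
  exact: normr_ge0.
exists 1 => _ [N _ <-]; rewrite /series/=.
under eq_bigr do rewrite normrEsg.
rewrite (_ : \sum_(_ <= _ < _) _ = f (\sum_(0 <= n < N)
    Num.sg (f (unit_vec n.+1)) *: unit_vec n.+1)); last first.
  by rewrite linear_sum; apply: eq_bigr => n _; rewrite linearZ.
apply: le_trans (ler_norm _) _; apply/(dual_sphere_le1 f1)/norm_sum_unit_vec_le1 => n.
by rewrite normr_sg; case: (_ != _); rewrite ?ler01.
Qed.

(** * Lower bound for convex combinations of slices *)

Hypothesis c1 : c%:num <= 1.

(** The new coordinate contributes at most [(1 - c) + c * |x 0|], and coordinate 0 is untouched, so
    the other seminorms do not change. *)
Lemma norm_update_le1 x n (s : R) : `|x| <= 1 -> `|s| <= 1 - c%:num ->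
  `|x + (s - x n.+1) *: unit_vec n.+1| <= 1.
Proof.
move=> x1 sc; apply: bseq_norm_le => m; set y := x + _.
have yE k : y k = x k + (s - x n.+1) * (k == n.+1)%:R by [].
rewrite /bseq_seminorm !yE mulr0 addr0.
have [->|mn] := eqVneq m n.+1.
  rewrite mulr1 subrKC mulr1n -[leRHS](subrK c%:num) lerD//.
  by rewrite ler_piMr// (le_trans (coord_le_bseq_norm 0 x)).
by rewrite mulr0 addr0; exact: le_trans (bseq_seminorm_le m x) x1.
Qed.

Lemma slice_contains_segment (f : {linear bseq c -> R^o}) a :
  dual_sphere f -> 0 < a -> \forall n \near \oo, exists y : bseq c,
    slice f a y /\ slice f a (y + (2 * (1 - c%:num)) *: unit_vec n.+1).
Proof.
move=> f1 a0; have [x [x1 fx]] := slice_neq0 f1 a0.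
(* Half the slack of [x] in the slice, because the update below has a coefficient of absolute value
   at most 2. *)
have e0 : 0 < (f x - (1 - a)) / 2 by rewrite divr_gt0// subr_gt0.
near=> n.
have fe : `|f (unit_vec n.+1)| < (f x - (1 - a)) / 2.
  near: n; apply: (@cvgr0_norm_lt R R) e0.
  exact: unit_vec_weakly_null.
pose y s := x + (s - x n.+1) *: unit_vec n.+1.
have ys s : `|s| <= 1 - c%:num -> slice f a (y s).
  move=> sc; split; first exact: norm_update_le1.
  rewrite linearD linearZ/=.
  have : `|(s - x n.+1) * f (unit_vec n.+1)| < f x - (1 - a).
    have xn : `|x n.+1| <= 1 by exact: le_trans (coord_le_bseq_norm _ _) x1.
    have : `|s - x n.+1| <= 2.
      rewrite (le_trans (ler_normB _ _))//.
      by rewrite (le_trans (lerD sc xn))// addrAC gerBl.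
    rewrite normrM => s2.
    apply: (@le_lt_trans _ _ (2 * `|f (unit_vec n.+1)|)).
      by rewrite ler_wpM2r.
    by rewrite mulrC -ltr_pdivlMr.
  rewrite -[_ *: _]/(_ * _) ltr_norml => /andP[+ _].
  by rewrite opprB ltrBlDl.
(* The two extreme admissible values of the coordinate are the endpoints. *)
exists (y (- (1 - c%:num))); split.
  by apply: ys; rewrite normrN ger0_norm ?subr_ge0.
rewrite (_ : _ + _ = y (1 - c%:num)).
  by apply: ys; rewrite ger0_norm ?subr_ge0.
rewrite /y -addrA -scalerDl; congr (_ + _ *: _); lra.
Unshelve. all: by end_near. Qed.

Lemma diam_convex_comb_slices_ge (C : set (bseq c)) :
  is_convex_comb_slices C -> ((2 * (1 - c%:num))%:E <= diam C)%E.
Proof.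
move=> [k [l [S [l01 l1 /choice[f /choice[a fa]] ->]]]].
(* Finitely many eventual properties hold together, giving one direction common to all slices. *)
have : \forall n \near \oo, forall i, exists y : bseq c,
    S i y /\ S i (y + (2 * (1 - c%:num)) *: unit_vec n.+1).
  apply: filter_forall => i; have [f1 a0 ->] := fa i.
  exact: slice_contains_segment.
move=> /filter_ex[n /choice[y yS]].
set d := 2 * _ in yS *.
pose p := \sum_(i < k) l i *: y i.
pose q := \sum_(i < k) l i *: (y i + d *: unit_vec n.+1).
apply: (@le_trans _ _ `|p - q|%:E); last first.
  apply: ereal_sup_ubound; exists p; first by exists y => // i; case: (yS i).
  exists q => //; exists (fun i => y i + d *: unit_vec n.+1) => // i.
  by case: (yS i).
(* All segments are translates of one another and the weights sum to 1, so the combination keeps the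
   full displacement. *)
rewrite /p /q -sumrB (_ : \sum_(i < k) _ = - (d *: unit_vec n.+1)); last first.
  rewrite -[in RHS](scale1r (d *: _)) -l1 scaler_suml -sumrN.
  by apply: eq_bigr => i _; rewrite -scalerBr opprD addNKr scalerN.
rewrite lee_fin normrN normrZ ger0_norm ?mulr_ge0 ?subr_ge0//.
by rewrite ler_peMr ?mulr_ge0 ?subr_ge0// norm_unit_vec_ge1.
Qed.

(** * A thin slice *)

Lemma coord0_dual_sphere : dual_sphere (coord 0 : {linear bseq c -> R^o}).
Proof.
split.
  apply: bounded_linear_continuous; apply/linear_boundedP; near=> r => x.
  apply: le_trans (coord_le_bseq_norm 0 x) _.
  by rewrite ler_peMl// (normr_ge0 x).
apply/eqP; rewrite eq_le; apply/andP; split.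
  apply: ge_sup; first by exists `|coord 0 0|, 0; rewrite // /unit_ball/= normr0.
  by move=> _ [x x1 <-]; exact: le_trans (coord_le_bseq_norm 0 x) x1.
apply: sup_upper_bound.
  split; first by exists `|coord 0 0|, 0; rewrite // /unit_ball/= normr0.
  by exists 1 => _ [x x1 <-]; exact: le_trans (coord_le_bseq_norm 0 x) x1.
(* The value 1 is attained here; this vector has norm at most 1 because [c <= 1]. *)
exists (unit_vec 0); last by rewrite /coord/= normr1.
apply: bseq_norm_le => -[|m]; rewrite /bseq_seminorm/= normr1 mulr1.
  by rewrite mulr0n addr0.
by rewrite normr0 add0r.
Unshelve. all: by end_near. Qed.

Lemma diam_slice_coord0_le a : 0 < a ->
  (diam (slice (coord 0 : {linear bseq c -> R^o}) a)
    <= (2 * (1 - c%:num) + 3 * a)%:E)%E.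
Proof.
move=> a0; apply: ge_ereal_sup => _ [x [x1 fx] [y [y1 fy] <-]].
have c0 : 0 <= c%:num by [].
have dist0 (s t : R) : 1 - a < s -> 1 - a < t -> `|s| <= 1 -> `|t| <= 1 ->
    `|s - t| <= a.
  rewrite !ler_norml => sa ta /andP[_ s1] /andP[_ t1]; apply/andP; split; lra.
have coord_bound (z : bseq c) n : unit_ball z -> 1 - a < z 0%N ->
    n != 0%N -> `|z n| <= 1 - c%:num * (1 - a).
  move=> z1 za n0; rewrite lerBrDr.
  apply: le_trans (le_trans (bseq_seminorm_le n z) z1).
  rewrite /bseq_seminorm n0 lerD2l ler_wpM2l// (le_trans (ltW za))//.
  exact: ler_norm.
have xy0 : `|x 0%N - y 0%N| <= a.
  by apply: dist0 => //; exact: le_trans (coord_le_bseq_norm 0 _) _.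
rewrite lee_fin; apply: bseq_norm_le => n; rewrite /bseq_seminorm !bseqBE.
have ca : c%:num * a <= a by rewrite ler_piMl// ltW.
have [->|n0] := eqVneq n 0%N.
  by rewrite mulr0n mul0r addr0 (le_trans xy0)//; move: c1 a0; lra.
(* The two coordinates at [n] and the term [c * |x 0 - y 0|] are bounded separately; the total is
   [2 * (1 - c) + 2 * c * a + a], and [c * a <= a]. *)
rewrite mulr1n; apply: (@le_trans _ _
    ((1 - c%:num * (1 - a)) + (1 - c%:num * (1 - a)) + a)); last by lra.
apply: lerD; last by rewrite (le_trans _ ca)// ler_wpM2l.
by rewrite (le_trans (ler_normB _ _))// lerD// coord_bound.
Qed.

End Norm.
End BoundedSequences.

Theorem corollary2p9 (R : realType) (delta : R) (hdelta : 0 < delta < 2) :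
  exists X : completeNormedModType R,
    [/\ exists x : X, x != 0,
        forall C : set X, is_convex_comb_slices C -> (delta%:E <= diam C)%E
      & forall eps : R, 0 < eps ->
          exists S : set X, is_slice S /\ (diam S <= (delta + eps)%:E)%E].
Proof.
have [d0 d2] := andP hdelta.
have c0 : 0 <= 1 - delta / 2 by lra.
pose c := NngNum c0.
have c1 : c%:num <= 1 by rewrite /c/=; lra.
have dE : delta = 2 * (1 - c%:num) by rewrite /c/=; lra.
exists (bseq c); split.
- exists (unit_vec c 0); rewrite -normr_gt0.
  exact: lt_le_trans ltr01 (norm_unit_vec_ge1 _ _).
- by move=> C; rewrite dE; exact: diam_convex_comb_slices_ge.
(* The choice [a = eps / 3] turns the error [3 * a] into [eps]. *)
- move=> eps e0; exists (slice (coord 0 : {linear bseq c -> R^o}) (eps / 3)).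
  have e3 : 0 < eps / 3 by rewrite divr_gt0.
  split.
    by exists (coord 0), (eps / 3); split=> //; exact: coord0_dual_sphere.
  apply: le_trans (diam_slice_coord0_le c1 e3) _.
  by rewrite lee_fin -dE mulrCA divff ?mulr1.
Qed.
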